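(* Suppose that $p=3$, and let $$\begin{aligned} O_1&=G(\langle x^p\rangle\oplus W),\\ O_2&=G(V\oplus\langle(x,x,y)\rangle),\\ O_3&=G(\langle x^p+(x,y,y),\ y^p,\ (x,x,y)\rangle),\\ O_4&=G(\langle x^p-(x,y,y),\ y^p,\ (x,x,y)\rangle),\\ O_5&=G(\langle x^p-(x,y,y),\ y^p+(x,y,y),\ (x,x,y)\rangle). \end{aligned}$$ Then $O_1\cup O_2\cup O_3\cup O_4\cup O_5$ is a disjoint union of all $3$-dimensional subspaces of $Z(F_p)$.
   Context: Elements of $\mathbb Z_p$ are identified with the integers $0,\dots,p-1$. For $0\le a,b<p$ let $(a,b)_p=0$ if $a+b<p$ and $(a,b)_p=1$ otherwise. $F_p$ is the commutative automorphic loop on $(\mathbb Z_p)^6$ with multiplication $$(a_1,\dots,a_6)(b_1,\dots,b_6)=(a_1+b_1,\ a_2+b_2,\ a_3+b_3+(a_1,b_1)_p,\ a_4+b_4+(a_2,b_2)_p,\ a_5+b_5-a_1b_1(a_2+b_2),\ a_6+b_6+a_2b_2(a_1+b_1)).$$ It is generated by $x=(1,0,0,0,0,0)$ and $y=(0,1,0,0,0,0)$. The associator is defined by $(ab)c=(a(bc))(a,b,c)$. The center $Z(F_p)=0\times0\times(\mathbb Z_p)^4$ is written additively as a $4$-dimensional vector space over $\mathbb Z_p$ with basis $x^p=(0,0,1,0,0,0)$, $y^p=(0,0,0,1,0,0)$, $(x,x,y)=(0,0,0,0,1,0)$, $(x,y,y)=(0,0,0,0,0,1)$. Let $V=\langle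 x^p\rangle\oplus\langle y^p\rangle$ and $W=\langle(x,x,y)\rangle\oplus\langle(x,y,y)\rangle$, where $\langle\cdot\rangle$ denotes linear span. The group $G=\mathrm{GL}_2(p)$ acts on $Z(F_p)$: $\rho=\begin{pmatrix}\alpha_1&\alpha_2\\ \beta_1&\beta_2\end{pmatrix}$ acts as the restriction to $Z(F_p)$ of the automorphism $\widehat\rho$ of $F_p$ determined by $\widehat\rho(x)=x^{\alpha_1}y^{\alpha_2}=(\alpha_1,\alpha_2,0,0,0,0)$, $\widehat\rho(y)=x^{\beta_1}y^{\beta_2}=(\beta_1,\beta_2,0,0,0,0)$. For a subspace $N$ of $Z(F_p)$, $G(N)=\{\widehat\rho(N):\rho\in G\}$ denotes its orbit. *)

(* Defs.v *)
From mathcomp Require Import all_boot all_order all_fingroup all_algebra.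
From mathcomp Require Import ring.

Set Implicit Arguments.
Unset Strict Implicit.
Unset Printing Implicit Defensive.

Import GRing.Theory.
Local Open Scope ring_scope.

(* Throughout, p is meant to be prime: then 'F_p is Z_p and its elements are   *)
(* literally the ordinals 0, ..., p - 1.                                       *)

(* Coordinates 1, ..., 6 on paper are the columns 0, ..., 5 here.              *)
Definition vec6 (p : nat) (a1 a2 a3 a4 a5 a6 : 'F_p) : 'rV['F_p]_6 :=
  \row_(i < 6) [:: a1; a2; a3; a4; a5; a6]`_i.

Definition carry (p : nat) (a b : 'F_p) : 'F_p :=
  if (nat_of_ord a + nat_of_ord b < p)%N then 0 else 1.

(* The carrier of the loop F_p is the type of row vectors 'rV['F_p]_6, whose   *)
(* library addition is NOT the loop multiplication; the two agree on the       *)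
(* center (lemma Fmul_center below).                                           *)
Definition Fmul (p : nat) (a b : 'rV['F_p]_6) : 'rV['F_p]_6 :=
  vec6 (a 0 0 + b 0 0)
       (a 0 1 + b 0 1)
       (a 0 2 + b 0 2 + carry (a 0 0) (b 0 0))
       (a 0 3 + b 0 3 + carry (a 0 1) (b 0 1))
       (a 0 4 + b 0 4 - a 0 0 * b 0 0 * (a 0 1 + b 0 1))
       (a 0 5 + b 0 5 + a 0 1 * b 0 1 * (a 0 0 + b 0 0)).

(* a (a ( ... (a 1))), with n factors a; the neutral element is the vector 0.  *)
Definition Fpow (p : nat) (a : 'rV['F_p]_6) (n : nat) : 'rV['F_p]_6 :=
  iter n (Fmul a) 0.

(* The d with (ab)c = (a(bc))d; it exists and is unique (lemma FassocP), so    *)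
(* the default value 0 is never used.                                          *)
Definition Fassoc (p : nat) (a b c : 'rV['F_p]_6) : 'rV['F_p]_6 :=
  odflt 0 [pick d | Fmul (Fmul a b) c == Fmul (Fmul a (Fmul b c)) d].

(* The center of a loop: the elements commuting with all elements and lying in *)
(* the left, middle and right nuclei.                                          *)
Definition Fcenter (p : nat) : {set 'rV['F_p]_6} :=
  [set a | [forall b, Fmul a b == Fmul b a] &&
    [forall b, forall c,
      [&& Fmul a (Fmul b c) == Fmul (Fmul a b) c,
          Fmul b (Fmul a c) == Fmul (Fmul b a) c &
          Fmul b (Fmul c a) == Fmul (Fmul b c) a]]].

Definition Fx (p : nat) : 'rV['F_p]_6 := vec6 1 0 0 0 0 0.
Definition Fy (p : nat) : 'rV['F_p]_6 := vec6 0 1 0 0 0 0.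

Definition xp (p : nat) : 'rV['F_p]_6 := Fpow (Fx p) p.
Definition yp (p : nat) : 'rV['F_p]_6 := Fpow (Fy p) p.
Definition xxy (p : nat) : 'rV['F_p]_6 := Fassoc (Fx p) (Fx p) (Fy p).
Definition xyy (p : nat) : 'rV['F_p]_6 := Fassoc (Fx p) (Fy p) (Fy p).

Definition Faut (p : nat) (phi : {perm 'rV['F_p]_6}) : Prop :=
  forall a b, phi (Fmul a b) = Fmul (phi a) (phi b).

(* phi is the automorphism of F_p attached to rho (x |-> x^alpha1 y^alpha2,    *)
(* y |-> x^beta1 y^beta2).                                                     *)
Definition is_hat (p : nat) (rho : {'GL_2(p)}) (phi : {perm 'rV['F_p]_6}) :
    Prop :=
  [/\ Faut phi,
      phi (Fx p) = Fmul (Fpow (Fx p) (GLval rho 0 0))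
                        (Fpow (Fy p) (GLval rho 0 1)) &
      phi (Fy p) = Fmul (Fpow (Fx p) (GLval rho 1 0))
                        (Fpow (Fy p) (GLval rho 1 1))].

(* Subspaces of Z(F_p) are the subspaces of 'rV['F_p]_6 contained in it.       *)
Definition center_subspace (p : nat) (N : {vspace 'rV['F_p]_6}) : Prop :=
  forall v, v \in N -> v \in Fcenter p.

Definition Gorbit (p : nat) (N M : {vspace 'rV['F_p]_6}) : Prop :=
  exists (rho : {'GL_2(p)}) (phi : {perm 'rV['F_p]_6}),
    is_hat rho phi /\ [set v | v \in M] = phi @: [set v | v \in N].

(* Lemmas xpE, ypE, xxyE, xyyE below give xp, yp, xxy, xyy in coordinates.     *)
Definition V (p : nat) : {vspace 'rV['F_p]_6} := (<[xp p]> + <[yp p]>)%VS.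
Definition W (p : nat) : {vspace 'rV['F_p]_6} := (<[xxy p]> + <[xyy p]>)%VS.

Lemma vec6E (p : nat) (a1 a2 a3 a4 a5 a6 : 'F_p) :
  let v := vec6 a1 a2 a3 a4 a5 a6 in
  (v 0 0 = a1) * (v 0 1 = a2) * (v 0 2 = a3) *
  (v 0 3 = a4) * (v 0 4 = a5) * (v 0 5 = a6).
Proof. by rewrite /= !mxE. Qed.

Lemma vec6P (p : nat) (u v : 'rV['F_p]_6) :
  u 0 0 = v 0 0 -> u 0 1 = v 0 1 -> u 0 2 = v 0 2 ->
  u 0 3 = v 0 3 -> u 0 4 = v 0 4 -> u 0 5 = v 0 5 -> u = v.
Proof.
move=> h0 h1 h2 h3 h4 h5; apply/rowP => i.
have /or3P[/eqP->|/eqP->|/or4P[] /eqP->] // :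
  [|| i == 0, i == 1 | [|| i == 2, i == 3, i == 4 | i == 5]].
by case: i => -[|[|[|[|[|[|//]]]]]].
Qed.

Lemma carryC (p : nat) (a b : 'F_p) : carry a b = carry b a.
Proof. by rewrite /carry addnC. Qed.

Lemma carry0r (p : nat) (a : 'F_p) : prime p -> carry 0 a = 0.
Proof. by move=> pp; rewrite /carry add0n ifT // -[X in (_ < X)%N](Fp_cast pp). Qed.

Lemma FmulC (p : nat) (a b : 'rV['F_p]_6) : Fmul a b = Fmul b a.
Proof.
by apply: vec6P; rewrite !vec6E ?[carry (b _ _) _]carryC
  ?(addrC (b _ _)) ?(mulrC (b _ _)).
Qed.

Lemma Fmul_center (p : nat) (a b : 'rV['F_p]_6) :
  prime p -> a 0 0 = 0 -> a 0 1 = 0 -> Fmul a b = a + b.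
Proof.
move=> pp a1 a2; apply: vec6P; rewrite !vec6E !mxE ?a1 ?a2 //.
- by rewrite carry0r ?addr0.
- by rewrite carry0r ?addr0.
- by rewrite !mul0r subr0.
- by rewrite !mul0r addr0.
Qed.

Lemma FassocP (p : nat) (a b c d : 'rV['F_p]_6) :
  Fmul (Fmul a b) c = Fmul (Fmul a (Fmul b c)) d <-> d = Fassoc a b c.
Proof.
have inj (u v w : 'rV['F_p]_6) : Fmul u v = Fmul u w -> v = w.
  move=> /rowP h.
  have := h 0; rewrite !vec6E => /addrI h0; have := h 1; rewrite !vec6E => /addrI h1.
  have := h 2; rewrite !vec6E h0 => /addIr/addrI h2.
  have := h 3; rewrite !vec6E h1 => /addIr/addrI h3.
  have := h 4; rewrite !vec6E h0 h1 => /addIr/addrI h4.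
  have := h 5; rewrite !vec6E h0 h1 => /addIr/addrI h5.
  exact: vec6P.
have ldiv (u w : 'rV['F_p]_6) : exists v, Fmul u v = w.
  by have [g _ gK] := injF_bij (inj u); exists (g w); apply: gK.
rewrite /Fassoc; case: pickP => [e /eqP he|h]; last first.
  have [v hv] := ldiv (Fmul a (Fmul b c)) (Fmul (Fmul a b) c).
  by have := h v; rewrite hv eqxx.
by split=> [|->//]; rewrite he => /inj.
Qed.

Lemma FcenterE (p : nat) (a : 'rV['F_p]_6) :
  prime p -> (a \in Fcenter p) = (a 0 0 == 0) && (a 0 1 == 0).
Proof.
move=> pp; rewrite inE; apply/idP/andP => [/andP[_ h]|[/eqP a1 /eqP a2]].
  split; apply/eqP.
    move/forallP/(_ (Fy p))/forallP/(_ (Fy p))/and3P: h => [_ _ /eqP/rowP/(_ 5)].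
    rewrite !vec6E !(add0r, addr0, mul0r, mulr0, mul1r, mulr1, subr0).
    by move=> /eqP; rewrite -subr_eq0 => /eqP <-; ring.
  move/forallP/(_ (Fx p))/forallP/(_ (Fx p))/and3P: h => [_ _ /eqP/rowP/(_ 4)].
  rewrite !vec6E !(add0r, addr0, mul0r, mulr0, mul1r, mulr1, subr0).
  by move=> /eqP; rewrite -subr_eq0 => /eqP e; apply: oppr_inj; rewrite oppr0 -e; ring.
have add b c : Fmul (a + b) c = a + Fmul b c.
  by apply: vec6P; rewrite !(vec6E, mxE) ?a1 ?a2 ?add0r ?addrA.
apply/andP; split; first by apply/forallP => b; rewrite FmulC.
apply/forallP => b; apply/forallP => c.
have addr' c' b' : Fmul c' (a + b') = a + Fmul c' b'.
  by rewrite FmulC add FmulC.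
have mulr_a u : Fmul u a = a + u by rewrite FmulC Fmul_center.
by rewrite !(mulr_a, Fmul_center (a := a)) // !(add, addr') !eqxx.
Qed.

Lemma carryr0 (p : nat) (a : 'F_p) : prime p -> carry a 0 = 0.
Proof. by move=> pp; rewrite carryC carry0r. Qed.

Lemma Fpow_xE (p k : nat) :
  prime p -> (k < p)%N -> Fpow (Fx p) k = vec6 k%:R 0 0 0 0 0.
Proof.
move=> pp; elim: k => [_|k IHk ltk]; first by apply: vec6P; rewrite !mxE.
rewrite /Fpow iterS -/(Fpow _ _) IHk ?(ltnW ltk) //; apply: vec6P;
  rewrite !vec6E ?carry0r // ?mul1r ?addr0 ?add0r ?mulr0 ?mul0r ?subr0 ?oppr0 //.
  by rewrite mulrS.
rewrite /carry [nat_of_ord k%:R]val_Fp_nat // [nat_of_ord 1](erefl : _ = 1%N).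
by rewrite !modn_small ?prime_gt1 ?(ltnW ltk) // add1n ltk.
Qed.

Lemma Fpow_yE (p k : nat) :
  prime p -> (k < p)%N -> Fpow (Fy p) k = vec6 0 k%:R 0 0 0 0.
Proof.
move=> pp; elim: k => [_|k IHk ltk]; first by apply: vec6P; rewrite !mxE.
rewrite /Fpow iterS -/(Fpow _ _) IHk ?(ltnW ltk) //; apply: vec6P;
  rewrite !vec6E ?carry0r // ?mul1r ?addr0 ?add0r ?mulr0 ?mul0r ?subr0 ?oppr0 //.
  by rewrite mulrS.
rewrite /carry [nat_of_ord k%:R]val_Fp_nat // [nat_of_ord 1](erefl : _ = 1%N).
by rewrite !modn_small ?prime_gt1 ?(ltnW ltk) // add1n ltk.
Qed.

Lemma carry1_pred (p k : nat) : prime p -> k.+1 = p -> carry 1 (k%:R : 'F_p) = 1.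
Proof.
move=> pp kp; rewrite /carry [nat_of_ord k%:R]val_Fp_nat //.
rewrite [nat_of_ord 1](erefl : _ = 1%N).
by rewrite !modn_small ?prime_gt1 // ?add1n ?kp ?ltnn // -{2}kp.
Qed.

Lemma xpE (p : nat) : prime p -> xp p = vec6 0 0 1 0 0 0.
Proof.
move=> pp; have kp := prednK (prime_gt0 pp).
have -> : xp p = Fmul (Fx p) (Fpow (Fx p) p.-1).
  by rewrite /Fpow -iterS kp.
rewrite Fpow_xE ?kp //; apply: vec6P;
  rewrite !vec6E ?carry0r // ?mul1r ?addr0 ?add0r ?mulr0 ?mul0r ?subr0 ?oppr0 //.
  by rewrite -mulrS kp pchar_Fp_0.
exact: carry1_pred.
Qed.

Lemma ypE (p : nat) : prime p -> yp p = vec6 0 0 0 1 0 0.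
Proof.
move=> pp; have kp := prednK (prime_gt0 pp).
have -> : yp p = Fmul (Fy p) (Fpow (Fy p) p.-1).
  by rewrite /Fpow -iterS kp.
rewrite Fpow_yE ?kp //; apply: vec6P;
  rewrite !vec6E ?carry0r // ?mul1r ?addr0 ?add0r ?mulr0 ?mul0r ?subr0 ?oppr0 //.
  by rewrite -mulrS kp pchar_Fp_0.
exact: carry1_pred.
Qed.

Lemma xxyE (p : nat) : prime p -> xxy p = vec6 0 0 0 0 1 0.
Proof.
move=> pp; apply/esym/FassocP; apply: vec6P;
  rewrite !vec6E ?(addr0, add0r, mulr0, mul0r, mulr1, mul1r, subr0, oppr0,
                   fun a : 'F_p => carry0r a pp, fun a : 'F_p => carryr0 a pp) //.
all: by ring.
Qed.

Lemma xyyE (p : nat) : prime p -> xyy p = vec6 0 0 0 0 0 1.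
Proof.
move=> pp; apply/esym/FassocP; apply: vec6P;
  rewrite !vec6E ?(addr0, add0r, mulr0, mul0r, mulr1, mul1r, subr0, oppr0,
                   fun a : 'F_p => carry0r a pp, fun a : 'F_p => carryr0 a pp) //.
all: by ring.
Qed.

(* Main.v *)
Require Import Defs.
From mathcomp Require Import all_boot all_order all_fingroup all_algebra.
From HB Require Import structures.
From mathcomp Require Import finfield ring.

Set Implicit Arguments.
Unset Strict Implicit.
Unset Printing Implicit Defensive.

Import GRing.Theory.
Local Open Scope ring_scope.

(** A 3-dimensional subspace of the center Z is the kernel [Zker f] of a nonzero
linear form f = (f1, f2, f3, f4) on Z, so the orbits can be studied on forms.

The orbits cover everything.  On the field with three elements the carry is a polynomial,
carry a b = 2ab - ab(a + b), that is, the coboundary of a^2 minus the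
polarization of a cube.  After this change every automorphism attached to a
matrix rho, with rows (a1, a2) and (b1, b2), has an explicit polynomial formula
([hat], [hatM]).  A cube in the loop is central, (s,t,...)^3 = (0,0,s,t,s^2 t,-s t^2)
([cubeE]); hence rho sends x^3 to (a1, a2, a1^2 a2, -a1 a2^2), y^3 to the same
expression in b, and it acts on W as det rho times the natural action.  This
gives the pulled back form [pull], with Zker (pull rho f) in the same orbit as
Zker f ([Gorbit_pull]), and a suitable rho brings every nonzero form to one of
five normal forms ([normal_form]), whose kernels are the five given subspaces
([span_rep1], [span_rep2], [span_rep345]).

The orbits are disjoint.  An automorphism permutes the set of all associators
and the set of all cubes, so two properties of a subspace N are constant on its
orbit: whether N contains all associators, and the number of cubes in N.  For
the five subspaces these take the values (yes, 3), (no, 5), (no, 3), (no, 7),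
(no, 1), which are distinct ([reps_disjoint]).

Finally, the members of the orbits are 3-dimensional subspaces of the center,
because automorphisms preserve the center and cardinals. *)

(** * Arithmetic in the field with three elements *)

Lemma F3_ind (P : 'F_3 -> Prop) : P 0 -> P 1 -> P (-1) -> forall x, P x.
Proof.
move=> P0 P1 P2 x.
have /or3P[]: [|| x == 0, x == 1 | x == -1] by case: x => -[|[|[|//]]].
all: by move=> /eqP ->.
Qed.

(** Quantifiers over F_3 as explicit boolean expressions, which reduce by
computation, unlike those that go through the locked enumeration of a finite
type. *)
Definition allF3 (P : 'F_3 -> bool) := [&& P 0, P 1 & P (-1)].
Definition hasF3 (P : 'F_3 -> bool) := [|| P 0, P 1 | P (-1)].

Lemma allF3P P : allF3 P -> forall x, P x.
Proof. by case/and3P => *; apply: (@F3_ind (fun x => P x)). Qed.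

Lemma hasF3P P : hasF3 P -> exists x, P x.
Proof. by case/or3P; eexists; eassumption. Qed.

Lemma sumF3 (F : 'F_3 -> nat) :
  (\sum_(s : 'F_3) F s = F 0%R + F 1%R + F (-1)%R)%N.
Proof.
rewrite (bigD1 (0 : 'F_3)) //= (bigD1 (1 : 'F_3)) //= (bigD1 (-1 : 'F_3)) //=.
by rewrite big1 ?addn0 ?addnA // => i; elim/F3_ind: i.
Qed.

Lemma three_eq0 : 3%:R = 0 :> 'F_3. Proof. exact/val_inj. Qed.

Lemma F3_cube (x : 'F_3) : x ^+ 3 = x.
Proof. by elim/F3_ind: x; apply/val_inj. Qed.

(** The lift of a + b to {0, 1, 2} is a + b - 3 carry a b; since u^3 = u + 3 g(u)
on lifts, expanding the cube of a + b expresses the carry through ab(a + b) and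
the coboundary of g.  Here g may be replaced by the square, as they differ by a
linear function. *)
Lemma carryE (a b : 'F_3) : carry a b = a * b *+ 2 - a * b * (a + b).
Proof. by elim/F3_ind: a; elim/F3_ind: b; apply/val_inj. Qed.

Lemma det2_inj (a1 a2 b1 b2 s t s' t' : 'F_3) : a1 * b2 - a2 * b1 != 0 ->
  a1 * s + b1 * t = a1 * s' + b1 * t' ->
  a2 * s + b2 * t = a2 * s' + b2 * t' -> s = s' /\ t = t'.
Proof.
move=> d e1 e2; split; apply: (mulfI d).
- transitivity (b2 * (a1 * s + b1 * t) - b1 * (a2 * s + b2 * t)); first ring.
  by rewrite e1 e2; ring.
- transitivity (a1 * (a2 * s + b2 * t) - a2 * (a1 * s + b1 * t)); first ring.
  by rewrite e1 e2; ring.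
Qed.

(** * The automorphism attached to an invertible matrix *)

(** The correction that makes a linear map compatible with carries: its
coboundary is the difference between the carry of the images and the image of
the carries ([carry_corrP]).  The last two terms are additive; they normalize
the value to 0 at (1, 0) and (0, 1). *)
Definition carry_corr (a b s t : 'F_3) : 'F_3 :=
  (a * s + b * t) ^+ 2 - a * s ^+ 2 - b * t ^+ 2
  - a ^+ 2 * b * s ^+ 2 * t - a * b ^+ 2 * s * t ^+ 2
  - (a ^+ 2 - a) * s - (b ^+ 2 - b) * t.

(** The same for the fifth coordinate; for the sixth, the first two
coordinates of the images are exchanged and the sign changes. *)
Definition assoc_corr (a1 a2 b1 b2 s t : 'F_3) : 'F_3 :=
  a1 ^+ 2 * a2 * (s - s ^+ 2) + b1 ^+ 2 * b2 * (t - t ^+ 2)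
  - a1 * b1 * a2 * s ^+ 2 * t - a1 * b1 * b2 * s * t ^+ 2.

Definition hat (a1 a2 b1 b2 : 'F_3) (v : 'rV['F_3]_6) : 'rV['F_3]_6 :=
  let d := a1 * b2 - a2 * b1 in
  vec6 (a1 * v 0 0 + b1 * v 0 1)
       (a2 * v 0 0 + b2 * v 0 1)
       (a1 * v 0 2 + b1 * v 0 3 + carry_corr a1 b1 (v 0 0) (v 0 1))
       (a2 * v 0 2 + b2 * v 0 3 + carry_corr a2 b2 (v 0 0) (v 0 1))
       (a1 ^+ 2 * a2 * v 0 2 + b1 ^+ 2 * b2 * v 0 3
        + d * (a1 * v 0 4 + b1 * v 0 5)
        + assoc_corr a1 a2 b1 b2 (v 0 0) (v 0 1))
       (- (a2 ^+ 2 * a1 * v 0 2) - b2 ^+ 2 * b1 * v 0 3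
        + d * (a2 * v 0 4 + b2 * v 0 5)
        - assoc_corr a2 a1 b2 b1 (v 0 0) (v 0 1)).

(** Carries commute with a linear form up to a coboundary because its
coefficients satisfy a^3 = a. *)
Lemma carry_corrP (a b s t s' t' : 'F_3) :
  carry_corr a b (s + s') (t + t') + a * carry s s' + b * carry t t' =
  carry_corr a b s t + carry_corr a b s' t'
  + carry (a * s + b * t) (a * s' + b * t').
Proof.
rewrite !carryE /carry_corr; apply/eqP; rewrite -subr_eq0; apply/eqP.
transitivity ((a ^+ 3 - a) * s * s' * (s + s')
              + (b ^+ 3 - b) * t * t' * (t + t')); first by ring.
by rewrite !F3_cube !subrr !mul0r addr0.
Qed.

(** In the last two coordinates the cocycle of the loop pulls back to its
multiple by the determinant, plus the coboundary of cubic monomials, plus a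
multiple of ab(a + b), which [carryE] trades for the third and fourth
coordinates. *)
Lemma hatM (a1 a2 b1 b2 : 'F_3) (u v : 'rV['F_3]_6) :
  hat a1 a2 b1 b2 (Fmul u v) =
  Fmul (hat a1 a2 b1 b2 u) (hat a1 a2 b1 b2 v).
Proof.
have carried (a b : 'F_3) :
    a * (u 0 2 + v 0 2 + carry (u 0 0) (v 0 0))
    + b * (u 0 3 + v 0 3 + carry (u 0 1) (v 0 1))
    + carry_corr a b (u 0 0 + v 0 0) (u 0 1 + v 0 1) =
    a * u 0 2 + b * u 0 3 + carry_corr a b (u 0 0) (u 0 1)
    + (a * v 0 2 + b * v 0 3 + carry_corr a b (v 0 0) (v 0 1))
    + carry (a * u 0 0 + b * u 0 1) (a * v 0 0 + b * v 0 1).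
  transitivity (a * (u 0 2 + v 0 2) + b * (u 0 3 + v 0 3)
    + (carry_corr a b (u 0 0 + v 0 0) (u 0 1 + v 0 1)
       + a * carry (u 0 0) (v 0 0) + b * carry (u 0 1) (v 0 1))); first by ring.
  by rewrite carry_corrP; ring.
apply: vec6P; rewrite /hat !vec6E; [ring|ring|exact: carried|exact: carried| |].
- by rewrite !carryE /assoc_corr; ring.
- by rewrite !carryE /assoc_corr; ring.
Qed.

(** The map is triangular with respect to the three pairs of coordinates, with
diagonal blocks rho, rho and (det rho) rho. *)
Lemma hat_inj (a1 a2 b1 b2 : 'F_3) :
  a1 * b2 - a2 * b1 != 0 -> injective (hat a1 a2 b1 b2).
Proof.
move=> d u v /rowP e.
have := e 0; have := e 1; rewrite !vec6E => e1 e0.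
have [h0 h1] := det2_inj d e0 e1.
have := e 2; have := e 3; rewrite !vec6E h0 h1 => /addIr e3 /addIr e2.
have [h2 h3] := det2_inj d e2 e3.
have := e 4; have := e 5; rewrite !vec6E h0 h1 h2 h3.
move=> /addIr/addrI/(mulfI d) e5 /addIr/addrI/(mulfI d) e4.
have [h4 h5] := det2_inj d e4 e5.
exact: vec6P.
Qed.

Lemma is_hat_hat (a1 a2 b1 b2 : 'F_3) (d : a1 * b2 - a2 * b1 != 0) :
  exists rho : {'GL_2(3)}, is_hat rho (perm (hat_inj d)).
Proof.
pose A : 'M['F_3]_2 :=
  \matrix_(i, j) (nth [::] [:: [:: a1; a2]; [:: b1; b2]] i)`_j.
have uA : A \is a GRing.unit.
  rewrite unitmxE unitfE (expand_det_row _ 0) !big_ord_recl big_ord0.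
  by rewrite /cofactor !det_mx11 !mxE /= expr0 mul1r addr0 expr1 mulN1r mulrN.
exists (FinRing.unit _ uA).
have powE (a b : 'F_3) :
    Fmul (Fpow (Fx 3) a) (Fpow (Fy 3) b) = vec6 a b 0 0 0 0.
  rewrite Fpow_xE ?Fpow_yE ?ltn_ord // !natr_Zp.
  by apply: vec6P; rewrite !vec6E ?carryE; ring.
split=> [u v||]; rewrite ?permE ?hatM ?powE //= !mxE /=;
  by apply: vec6P; rewrite /hat /carry_corr /assoc_corr !vec6E; ring.
Qed.

(** * Subspaces of the center as kernels of linear forms *)

Definition zform := ('F_3 * 'F_3 * 'F_3 * 'F_3)%type.

Definition feval (f : zform) (z : 'rV['F_3]_6) : 'F_3 :=
  let: (f1, f2, f3, f4) := f in
  f1 * z 0 2 + f2 * z 0 3 + f3 * z 0 4 + f4 * z 0 5.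

(** The first two entries cut out the center, so that [Zker] is a kernel in the
full space of row vectors. *)
Definition zcoords (f : zform) (z : 'rV['F_3]_6) : 'rV['F_3]_3 :=
  \row_i [:: z 0 0; z 0 1; feval f z]`_i.

Lemma zcoords_linear f : linear (zcoords f).
Proof.
case: f => [[[f1 f2] f3] f4] k u v.
apply/rowP => -[[|[|[|//]]] i3]; rewrite !mxE //=.
by rewrite !mxE; ring.
Qed.

HB.instance Definition _ f :=
  GRing.isLinear.Build 'F_3 'rV['F_3]_6 'rV['F_3]_3 _ (zcoords f)
    (zcoords_linear f).

Definition Zker (f : zform) : {vspace 'rV['F_3]_6} := lker (linfun (zcoords f)).

Lemma mem_Zker f z :
  (z \in Zker f) = [&& z 0 0 == 0, z 0 1 == 0 & feval f z == 0].
Proof.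
rewrite memv_ker lfunE /=.
apply/eqP/and3P => [/rowP h|[/eqP h0 /eqP h1 /eqP h2]].
  by have := (h 0, h 1, h 2); rewrite !mxE /= => -[[-> ->] ->].
by apply/rowP => -[[|[|[|//]]] i3]; rewrite !mxE.
Qed.

Fact prime3 : prime 3. Proof. by []. Qed.

Lemma center_gen (z : 'rV['F_3]_6) : z 0 0 = 0 -> z 0 1 = 0 ->
  z = z 0 2 *: xp 3 + z 0 3 *: yp 3 + z 0 4 *: xxy 3 + z 0 5 *: xyy 3.
Proof.
move=> h0 h1.
rewrite (xpE prime3) (ypE prime3) (xxyE prime3) (xyyE prime3).
by apply: vec6P; rewrite !mxE /= ?h0 ?h1; ring.
Qed.

(** The forms that vanish on a basis of N are the solutions of at most three
homogeneous equations in four unknowns. *)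
Lemma sub_Zker (N : {vspace 'rV['F_3]_6}) :
  center_subspace N -> (\dim N <= 3)%N ->
  exists2 f, f != (0, 0, 0, 0) & (N <= Zker f)%VS.
Proof.
move=> cN dN.
pose B := \matrix_(i < 4, j < \dim N) (vbasis N)`_j 0 (rshift 2 i).
have : kermx B != 0.
  by rewrite kermx_eq0 -row_leq_rank -ltnNge (leq_ltn_trans (rank_leq_col B)).
case/rowV0Pn => g /sub_kermxP/rowP gB g0.
exists (g 0 0, g 0 1, g 0 2, g 0 3).
  apply: contraNneq g0 => -[e0 e1 e2 e3].
  apply/eqP/rowP => -[[|[|[|[|//]]]] i4]; rewrite mxE;
    [rewrite -e0|rewrite -e1|rewrite -e2|rewrite -e3];
    by congr (g _ _); apply: val_inj.
rewrite -(span_basis (vbasisP N)); apply/span_subvP => z zN.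
have /andP[h0 h1] : (z 0 0 == 0) && (z 0 1 == 0).
  by rewrite -FcenterE // cN // vbasis_mem.
rewrite mem_Zker h0 h1 /=.
have ltj : (index z (vbasis N) < \dim N)%N.
  by rewrite -[X in (_ < X)%N](size_tuple (vbasis N)) index_mem.
have := gB (Ordinal ltj); rewrite !mxE => gz; apply/eqP; rewrite -[RHS]gz.
rewrite !big_ord_recl big_ord0 !mxE /= nth_index // addr0 !addrA.
by repeat congr (_ + _); congr (g _ _ * z _ _); apply: val_inj.
Qed.

(** The kernel of three linear functions in dimension 6 has dimension at least 3.
A nonzero form does not vanish on all of Z, which is spanned by four vectors, so
its kernel in Z has dimension at most 3. *)
Lemma dim_Zker f : f != (0, 0, 0, 0) -> \dim (Zker f) = 3%N.
Proof.
move=> f0; apply/eqP; rewrite eqn_leq; apply/andP; split; last first.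
  have := limg_ker_dim (linfun (zcoords f)) fullv.
  rewrite capfv -/(Zker f) dimvf /dim /= => e.
  rewrite -(leq_add2r (\dim (limg (linfun (zcoords f))))) e.
  by rewrite -[X in (_ <= X)%N]/(3 + 3)%N leq_add2l; apply: rank_leq_col.
rewrite -ltnS.
pose Z := <<[:: xp 3; yp 3; xxy 3; xyy 3]>>%VS.
apply: leq_trans (dim_span [:: xp 3; yp 3; xxy 3; xyy 3]); rewrite -/Z.
have gZ : [/\ xp 3 \in Z, yp 3 \in Z, xxy 3 \in Z & xyy 3 \in Z].
  by split; apply: memv_span; rewrite !inE eqxx ?orbT.
case: gZ => gx gy gxx gyy.
have sZ : (Zker f <= Z)%VS.
  apply/subvP => z; rewrite mem_Zker => /and3P[/eqP h0 /eqP h1 _].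
  by rewrite (center_gen h0 h1) !memvD ?memvZ.
rewrite ltn_neqAle dimvS // andbT; apply: contraNN f0 => /eqP dZ.
have /eqP e : Zker f == Z by rewrite eqEdim sZ dZ /=.
move: gx gy gxx gyy; rewrite -e !mem_Zker.
rewrite (xpE prime3) (ypE prime3) (xxyE prime3) (xyyE prime3).
case: f {sZ dZ e} => [[[f1 f2] f3] f4]; rewrite /feval !vec6E eqxx /=.
rewrite !mulr0 !mulr1 !addr0 !add0r.
by move=> /eqP-> /eqP-> /eqP-> /eqP->.
Qed.

Lemma ZkerP (N : {vspace 'rV['F_3]_6}) : center_subspace N -> \dim N = 3%N ->
  exists2 f, f != (0, 0, 0, 0) & N = Zker f.
Proof.
move=> cN dN; have [|f f0 sN] := @sub_Zker N cN; first by rewrite dN.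
by exists f => //; apply/eqP; rewrite eqEdim sN dim_Zker ?dN.
Qed.

Lemma span_rep1 : (<[xp 3]> + W 3)%VS = Zker (0, 1, 0, 0).
Proof.
rewrite /W -!span_seq1 -!span_cat /=; apply/vspaceP => z; apply/idP/idP.
  apply/subvP: z; apply/span_subvP => z.
  rewrite !inE (xpE prime3) (xxyE prime3) (xyyE prime3).
  case/or3P => /eqP->; rewrite mem_Zker /feval !vec6E;
  by apply/and3P; split; apply/eqP; ring.
rewrite mem_Zker /feval => /and3P[/eqP h0 /eqP h1 /eqP h].
rewrite (center_gen h0 h1).
have -> : z 0 3 = 0 by rewrite -h; ring.
by rewrite scale0r addr0 !memvD ?memvZ // memv_span // !inE eqxx ?orbT.
Qed.

Lemma span_rep2 : (V 3 + <[xxy 3]>)%VS = Zker (0, 0, 0, 1).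
Proof.
rewrite /V -!span_seq1 -!span_cat /=; apply/vspaceP => z; apply/idP/idP.
  apply/subvP: z; apply/span_subvP => z.
  rewrite !inE (xpE prime3) (ypE prime3) (xxyE prime3).
  case/or3P => /eqP->; rewrite mem_Zker /feval !vec6E;
  by apply/and3P; split; apply/eqP; ring.
rewrite mem_Zker /feval => /and3P[/eqP h0 /eqP h1 /eqP h].
rewrite (center_gen h0 h1).
have -> : z 0 5 = 0 by rewrite -h; ring.
by rewrite scale0r addr0 !memvD ?memvZ // memv_span // !inE eqxx ?orbT.
Qed.

Lemma span_rep345 (s t : 'F_3) :
  <<[:: (xp 3 - s *: xyy 3)%R; (yp 3 + t *: xyy 3)%R; xxy 3]>>%VS =
  Zker (s, - t, 0, 1).
Proof.
apply/vspaceP => z; apply/idP/idP.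
  apply/subvP: z; apply/span_subvP => z.
  rewrite !inE (xpE prime3) (ypE prime3) (xxyE prime3) (xyyE prime3).
  case/or3P => /eqP->; rewrite mem_Zker /feval;
  by apply/and3P; split; apply/eqP; rewrite !mxE /=; ring.
rewrite mem_Zker /feval; case/and3P=> /eqP h0 /eqP h1 /eqP h.
rewrite (center_gen h0 h1).
have -> : z 0 5 = - s * z 0 2 + t * z 0 3.
  by apply/eqP; rewrite -subr_eq0; apply/eqP; rewrite -h; ring.
rewrite (_ : _ + _ = z 0 2 *: (xp 3 - s *: xyy 3)
                     + z 0 3 *: (yp 3 + t *: xyy 3) + z 0 4 *: xxy 3).
  by rewrite !memvD ?memvZ // memv_span // !inE eqxx ?orbT.
(* Abstracting the generators keeps them from being unfolded below. *)
move: (xp 3) (yp 3) (xxy 3) (xyy 3) => X Y U T.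
by apply/rowP=> i; rewrite !mxE; ring.
Qed.

(** * Normal forms *)

(** The composite of a form with the action of rho on the center. *)
Definition pull (a1 a2 b1 b2 : 'F_3) (f : zform) : zform :=
  let: (f1, f2, f3, f4) := f in
  let d := a1 * b2 - a2 * b1 in
  (f1 * a1 + f2 * a2 + f3 * (a1 ^+ 2 * a2) - f4 * (a2 ^+ 2 * a1),
   f1 * b1 + f2 * b2 + f3 * (b1 ^+ 2 * b2) - f4 * (b2 ^+ 2 * b1),
   d * (f3 * a1 + f4 * a2), d * (f3 * b1 + f4 * b2)).

Lemma mem_Zker_hat (a1 a2 b1 b2 : 'F_3) f v : a1 * b2 - a2 * b1 != 0 ->
  (hat a1 a2 b1 b2 v \in Zker f) = (v \in Zker (pull a1 a2 b1 b2 f)).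
Proof.
case: f => [[[f1 f2] f3] f4] d; rewrite !mem_Zker /feval !vec6E !andbA.
have -> : (a1 * v 0 0 + b1 * v 0 1 == 0) && (a2 * v 0 0 + b2 * v 0 1 == 0)
          = (v 0 0 == 0) && (v 0 1 == 0).
  apply/andP/andP => -[/eqP h0 /eqP h1].
    have [||-> ->] := @det2_inj _ _ _ _ (v 0 0) (v 0 1) 0 0 d;
      by rewrite ?h0 ?h1 ?mulr0 ?addr0.
  by rewrite h0 h1 !mulr0 addr0 eqxx.
case: eqP => //= ->; case: eqP => //= ->; congr (_ == 0).
by rewrite /carry_corr /assoc_corr; ring.
Qed.

Lemma Gorbit_pull (a1 a2 b1 b2 : 'F_3) f : a1 * b2 - a2 * b1 != 0 ->
  Gorbit (Zker (pull a1 a2 b1 b2 f)) (Zker f).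
Proof.
move=> d; have [rho hrho] := is_hat_hat d; exists rho, (perm (hat_inj d)).
split=> //; apply/setP => w; rewrite -(permKV (perm (hat_inj d)) w).
by rewrite mem_imset ?inE; [rewrite permE mem_Zker_hat | exact: perm_inj].
Qed.

Definition reps : 5.-tuple zform :=
  [tuple (0, 1, 0, 0); (0, 0, 0, 1); (-1, 0, 0, 1); (1, 0, 0, 1); (1, -1, 0, 1)].

(** If (f3, f4) is nonzero, take (a1, a2) = (f4, -f3).  Then the determinant is
d = f3 b1 + f4 b2, and f pulls back to (I, J, 0, d^2) = (I, J, 0, 1), where
I = f1 f4 - f2 f3 + f3^2 f4^2.  Adding s (a1, a2) to (b1, b2) adds (I - 1) s to
J: if I is 0 or -1, this kills J; if I = 1, then J is determined up to the sign,
which changes with that of (b1, b2), so that J may be taken in {0, -1}.  If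
f3 = f4 = 0, then (a1, a2) = (f2, -f1) and d = f1 b1 + f2 b2 = 1 lead to
(0, 1, 0, 0).  With (a1, a2) prescribed in this way, the existence of (b1, b2)
is a finite check. *)
Lemma normal_form f : f != (0, 0, 0, 0) ->
  exists a1 a2 b1 b2,
    a1 * b2 - a2 * b1 != 0 /\ pull a1 a2 b1 b2 f \in (reps : seq zform).
Proof.
case: f => [[[f1 f2] f3] f4].
pose T (f1 f2 f3 f4 : 'F_3) :=
  let: (a1, a2) := if (f3 == 0) && (f4 == 0) then (f2, - f1) else (f4, - f3) in
  ((f1, f2, f3, f4) == (0, 0, 0, 0) :> zform) ||
  hasF3 (fun b1 => hasF3 (fun b2 => (a1 * b2 - a2 * b1 != 0) &&
    (pull a1 a2 b1 b2 (f1, f2, f3, f4) \in (reps : seq zform)))).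
have h : allF3 (fun f1 => allF3 (fun f2 => allF3 (fun f3 => allF3 (fun f4 =>
    T f1 f2 f3 f4)))) by vm_compute.
have := allF3P (allF3P (allF3P (allF3P h f1) f2) f3) f4; rewrite /T.
case: (if _ then _ else _) => a1 a2 /orP[/eqP->|]; first by rewrite eqxx.
case/hasF3P=> b1 /hasF3P[b2 /andP[d r]] _; exists a1, a2, b1, b2.
exact: (conj d r).
Qed.

(** * What automorphisms preserve *)

Lemma aut_center (p : nat) (phi : {perm 'rV['F_p]_6}) (phiM : Faut phi) v :
  v \in Fcenter p -> phi v \in Fcenter p.
Proof.
rewrite !inE => /andP[/forallP h1 /forallP h2]; apply/andP; split.
  by apply/forallP => b; rewrite -[b](permKV phi) -!phiM (eqP (h1 _)).
apply/forallP => b; apply/forallP => c.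
rewrite -[b](permKV phi) -[c](permKV phi) -!phiM !(inj_eq perm_inj).
exact: (forallP (h2 _)).
Qed.

Lemma aut_assoc (p : nat) (phi : {perm 'rV['F_p]_6}) (phiM : Faut phi) a b c :
  phi (Fassoc a b c) = Fassoc (phi a) (phi b) (phi c).
Proof. by apply/FassocP; rewrite -!phiM; congr (phi _); apply/FassocP. Qed.

(** 0 is the only idempotent: its first two coordinates double to themselves, so
they vanish, and on such vectors the product is the sum. *)
Lemma aut0 (p : nat) (phi : {perm 'rV['F_p]_6}) :
  prime p -> Faut phi -> phi 0 = 0.
Proof.
move=> p_pr phiM; have idem : Fmul (phi 0) (phi 0) = phi 0.
  by rewrite -phiM Fmul_center ?mxE ?add0r.
have double (A : zmodType) (x : A) : x + x = x -> x = 0.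
  by move/eqP; rewrite -subr_eq0 addrK => /eqP.
have /rowP e := idem; have := (e 0, e 1).
rewrite !vec6E => -[/double e0 /double e1].
by move: idem; rewrite Fmul_center // => /double.
Qed.

Lemma aut_Fpow (p : nat) (phi : {perm 'rV['F_p]_6}) a n :
  prime p -> Faut phi -> phi (Fpow a n) = Fpow (phi a) n.
Proof.
move=> p_pr phiM; elim: n => [|n IHn]; rewrite /Fpow ?aut0 //.
by rewrite !iterS phiM -/(Fpow a n) IHn.
Qed.

Lemma aut_mem (p : nat) (phi : {perm 'rV['F_p]_6})
    (N M : {vspace 'rV['F_p]_6}) v :
  [set v | v \in M] = phi @: [set v | v \in N] -> (phi v \in M) = (v \in N).
Proof.
by move=> /setP/(_ (phi v)); rewrite mem_imset ?inE //; apply: perm_inj.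
Qed.

Lemma Gorbit_center (p : nat) (N M : {vspace 'rV['F_p]_6}) :
  Gorbit N M -> center_subspace N -> center_subspace M.
Proof.
case=> rho [phi [[phiM _ _] /aut_mem memM]] cN v.
by rewrite -[v](permKV phi) memM => /cN/(aut_center phiM).
Qed.

Lemma Gorbit_dim (N M : {vspace 'rV['F_3]_6}) : Gorbit N M -> \dim M = \dim N.
Proof.
case=> rho [phi [_ e]].
have := congr1 (fun A : {set _} => #|A|) e.
rewrite card_imset; last exact: perm_inj.
by rewrite !cardsE !card_vspace => /eqP; rewrite eqn_exp2l ?card_Fp // => /eqP.
Qed.

Definition has_assocs (N : {vspace 'rV['F_3]_6}) :=
  [forall a, [forall b, [forall c, Fassoc a b c \in N]]].

Definition cubes : {set 'rV['F_3]_6} := [set Fpow a 3 | a in setT].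

Lemma Gorbit_has_assocs N M : Gorbit N M -> has_assocs M = has_assocs N.
Proof.
case=> rho [phi [[phiM _ _] /aut_mem memM]]; apply/idP/idP.
  move=> /'forall_'forall_forallP h; apply/'forall_'forall_forallP => a b c.
  by rewrite -memM aut_assoc.
move=> /'forall_'forall_forallP h; apply/'forall_'forall_forallP => a b c.
by rewrite -[a](permKV phi) -[b](permKV phi) -[c](permKV phi) -aut_assoc // memM.
Qed.

Lemma Gorbit_cubes N M : Gorbit N M ->
  #|cubes :&: [set v | v \in M]| = #|cubes :&: [set v | v \in N]|.
Proof.
case=> rho [phi [[phiM _ _] ->]].
suff {1}-> : cubes = phi @: cubes.
  rewrite -imsetI ?card_imset //; first exact: perm_inj.
  by move=> ? ? _ _; exact: perm_inj.
apply/setP => v; apply/imsetP/imsetP => [[a _ ->]|[_ /imsetP[a _ ->] ->]].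
  exists (Fpow (phi^-1%g a) 3); first exact: imset_f.
  by rewrite aut_Fpow // permKV.
by exists (phi a); rewrite ?aut_Fpow.
Qed.

(** * The invariants of the five subspaces *)

Lemma assocE (a b c : 'rV['F_3]_6) :
  Fassoc a b c = vec6 0 0 0 0 ((a 0 0 * c 0 1 - a 0 1 * c 0 0) * b 0 0)
                              ((a 0 0 * c 0 1 - a 0 1 * c 0 0) * b 0 1).
Proof.
by apply/esym/FassocP; apply: vec6P; rewrite !vec6E ?carryE; ring.
Qed.

Lemma has_assocs_Zker f1 f2 f3 f4 :
  has_assocs (Zker (f1, f2, f3, f4)) = (f3 == 0) && (f4 == 0).
Proof.
apply/'forall_'forall_forallP/andP => [h|[/eqP f3_0 /eqP f4_0] a b c].
  have := h (Fx 3) (Fx 3) (Fy 3); have := h (Fx 3) (Fy 3) (Fy 3).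
  rewrite !assocE !mem_Zker /feval !vec6E.
  move=> /and3P[_ _ /eqP e4] /and3P[_ _ /eqP e3].
  by split; apply/eqP; [rewrite -e3|rewrite -e4]; ring.
rewrite assocE mem_Zker /feval !vec6E f3_0 f4_0 eqxx /=.
by apply/eqP; ring.
Qed.

Definition cube_of (st : 'F_3 * 'F_3) : 'rV['F_3]_6 :=
  let: (s, t) := st in vec6 0 0 s t (s ^+ 2 * t) (- (s * t ^+ 2)).

(** The third and fourth entries are the carries in 3a, computed modulo 9; the
last two sum the cocycle along the powers of a, 1 * 2 + 2 * 3 = -1 modulo 3. *)
Lemma cubeE (a : 'rV['F_3]_6) : Fpow a 3 = cube_of (a 0 0, a 0 1).
Proof.
(* Each entry agrees with the claimed one up to a multiple of 3, inserted
   explicitly to leave a polynomial identity over the integers. *)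
have m3 (x y : 'F_3) : 3%:R * x + y = y by rewrite three_eq0 mul0r add0r.
apply: vec6P; rewrite /Fpow /= !vec6E ?carryE !mxE.
- by rewrite -[RHS](m3 (a 0 0)); ring.
- by rewrite -[RHS](m3 (a 0 1)); ring.
- rewrite -[in RHS](F3_cube (a 0 0)).
  rewrite -[RHS](m3 (a 0 2 + 2%:R * a 0 0 ^+ 2 - 3%:R * a 0 0 ^+ 3)).
  by ring.
- rewrite -[in RHS](F3_cube (a 0 1)).
  rewrite -[RHS](m3 (a 0 3 + 2%:R * a 0 1 ^+ 2 - 3%:R * a 0 1 ^+ 3)).
  by ring.
- by rewrite -[RHS](m3 (a 0 4 - 3%:R * a 0 0 ^+ 2 * a 0 1)); ring.
- by rewrite -[RHS](m3 (a 0 5 + 3%:R * a 0 0 * a 0 1 ^+ 2)); ring.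
Qed.

(** A cube is determined by its third and fourth coordinates s and t, which are
arbitrary, so counting cubes amounts to counting the zeros (s, t) of a cubic. *)
Lemma card_cubes_Zker f1 f2 f3 f4 :
  #|cubes :&: [set v | v \in Zker (f1, f2, f3, f4)]| =
  (\sum_(s : 'F_3) \sum_(t : 'F_3)
     (f1 * s + f2 * t + f3 * (s ^+ 2 * t) - f4 * (s * t ^+ 2) == 0)%R)%N.
Proof.
pose P s t := f1 * s + f2 * t + f3 * (s ^+ 2 * t) - f4 * (s * t ^+ 2) == 0.
have -> : cubes :&: [set v | v \in Zker (f1, f2, f3, f4)] =
          cube_of @: [set st | P st.1 st.2].
  have memP s t : (cube_of (s, t) \in Zker (f1, f2, f3, f4)) = P s t.
    by rewrite mem_Zker /feval !vec6E eqxx /= mulrN.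
  apply/setP => v; rewrite !inE.
  apply/andP/imsetP => [[/imsetP[a _ ->]]|[[s t]]].
    by rewrite cubeE memP => Pa; exists (a 0 0, a 0 1); rewrite ?inE.
  rewrite inE /= -memP => Pst ->; split=> //; apply/imsetP.
  by exists (vec6 s t 0 0 0 0); rewrite ?inE // cubeE !vec6E.
rewrite card_imset; last first.
  move=> [s t] [s' t'] /rowP e; have := (e 2, e 3).
  by rewrite !vec6E => -[-> ->].
rewrite -sum1dep_card big_mkcond pair_big.
by apply: eq_bigr => -[s t] _; rewrite -/(P s t); case: (P s t).
Qed.

(** For f3 = 0 and f4 = 1 the cubic is f1 s + f2 t - s t^2, with 5, 3, 7 and 1
zeros for the last four representatives.  The first one also has 3, but it is
the only one that contains W, the set of all associators. *)
Lemma reps_disjoint (i j : 'I_5) N :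
  Gorbit (Zker (tnth reps i)) N -> Gorbit (Zker (tnth reps j)) N -> i = j.
Proof.
pose inv N := (has_assocs N, #|cubes :&: [set v | v \in N]|).
pose values :=
  [tuple (true, 3); (false, 5); (false, 3); (false, 7); (false, 1)]%N.
have invG k : Gorbit (Zker (tnth reps k)) N -> inv N = inv (Zker (tnth reps k)).
  by move=> G; rewrite /inv (Gorbit_has_assocs G) (Gorbit_cubes G).
have invE k : inv (Zker (tnth reps k)) = tnth values k.
  by case: k => -[|[|[|[|[|//]]]]] k5;
    rewrite /inv (tnth_nth (0, 0, 0, 0)) (tnth_nth (true, 0%N)) /=
      has_assocs_Zker card_cubes_Zker !sumF3; vm_compute.
move=> /invG ei /invG ej; have : tnth values i = tnth values j.
  by rewrite -!invE -ei -ej.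
by move/tuple_uniqP => ->.
Qed.

Theorem proposition5p4 :
  let O1 := Gorbit (<[xp 3]> + W 3)%VS in
  let O2 := Gorbit (V 3 + <[xxy 3]>)%VS in
  let O3 := Gorbit <<[:: (xp 3 + xyy 3)%R; yp 3; xxy 3]>>%VS in
  let O4 := Gorbit <<[:: (xp 3 - xyy 3)%R; yp 3; xxy 3]>>%VS in
  let O5 := Gorbit <<[:: (xp 3 - xyy 3)%R; (yp 3 + xyy 3)%R; xxy 3]>>%VS in
  let O := [tuple O1; O2; O3; O4; O5] in
  (forall N : {vspace 'rV['F_3]_6},
      (exists i : 'I_5, tnth O i N) <->
      (center_subspace N /\ \dim N = 3%N)) /\
  (forall (i j : 'I_5) (N : {vspace 'rV['F_3]_6}),
      tnth O i N -> tnth O j N -> i = j).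
Proof.
move=> O1 O2 O3 O4 O5 O.
have E3 := span_rep345 (-1) 0.
have E4 := span_rep345 1 0.
have E5 := span_rep345 1 1.
rewrite !(scaleN1r, opprK, scale0r, addr0, oppr0, scale1r) in E3 E4 E5.
have OE i : tnth O i = Gorbit (Zker (tnth reps i)).
  rewrite /O /O1 /O2 /O3 /O4 /O5 span_rep1 span_rep2 E3 E4 E5.
  by case: i => -[|[|[|[|[|//]]]]] i5.
split=> [N|i j N]; last by rewrite !OE; apply: reps_disjoint.
split=> [[i]|[cN dN]].
  rewrite OE => G; split.
    apply: (Gorbit_center G) => v; rewrite mem_Zker FcenterE //.
    by case/and3P=> -> ->.
  rewrite (Gorbit_dim G) dim_Zker //.
  by case: i {G} => -[|[|[|[|[|//]]]]] i5.
have [f f0 ->] := ZkerP cN dN.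
have [a1 [a2 [b1 [b2 [d /tnthP[i fi]]]]]] := normal_form f0.
by exists i; rewrite OE -fi; apply: Gorbit_pull.
Qed.
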